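(* For every instance of FZA, the Single Density algorithm outputs a (random) set $F_{\mathrm{ALG}}\subseteq E$ with $\mathbb{E}[\sum_{i}\mathrm{rev}_i(F_{\mathrm{ALG}})]\ge \mathrm{OPT}/\mathcal{O}(\log n)$, where $\mathrm{OPT}$ is the optimal revenue; i.e., it computes an $\mathcal{O}(\log n)$-approximation for FZA in expectation.
   Context: Fare Zone Assignment (FZA): given a tree $T=(V,E)$ with $n=|V|$, a non-decreasing concave function $f\colon\mathbb{N}_0\to\mathbb{R}_{\ge 0}$, and commodities $i\in[k]$, each given by a path $P_i\subseteq E$, a bound $u_i\in\mathbb{N}_0$ and a weight $w_i\in\mathbb{N}$, find $F\subseteq E$ maximizing $\mathrm{rev}(F)=\sum_{i\in[k]}\mathrm{rev}_i(F)$, where $\mathrm{rev}_i(F)=w_i f(|P_i\cap F|)$ if $|P_i\cap F|\le u_i$ and $0$ otherwise. Single Density algorithm: let $d_i=u_i/|P_i|$ (density). Define $M_0=\{i: u_i=0\}$ and, for $j\in\{1,\dots,\lceil\log_2 n\rceil\}$, $M_j=\{i: u_i\ge1,\ d_i\in(2^{-j},2^{1-j}]\}$. Set $F_0=\emptyset$. Fix an arbitrary root $r\in V$; for an edge $e$ let $\mathrm{dist}(r,e)$ be the number of edges other than $e$ on the unique path from $e$ to $r$. For each $j\ge1$ and each $\theta\in\{0,\dots,2^{j+1}-1\}$ let $F_{j,\theta}=\{e\in E:\mathrm{dist}(r,e)\equiv\theta \bmod 2^{j+1}\}$, and obtain $F_{j,\theta}^{(\mathrm{rand})}$ by deleting each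 edge of $F_{j,\theta}$ independently with probability $1/2$; let $F_j$ be a best (maximum revenue) set among the $F^{(\mathrm{rand})}_{j,\theta}$. The output $F_{\mathrm{ALG}}$ is a best set among $F_0,F_1,\dots,F_{\lceil\log_2 n\rceil}$. *)

(* Defs.v *)
From HB Require Import structures.
From mathcomp Require Import all_boot all_order all_algebra.
From mathcomp Require Import reals exp.

Set Implicit Arguments.
Unset Strict Implicit.
Unset Printing Implicit Defensive.

Import Order.TTheory GRing.Theory Num.Theory.
Local Open Scope ring_scope.

Section Graphs.
Variables (V : finType) (adj : rel V).

(* Edges are two-element vertex sets. *)
Definition edge_set : {set {set V}} :=
  [set [set x; y] | x in V, y in V & adj x y].

Definition simple_path (s : seq V) : bool := sorted adj s && uniq s.

Definition path_edges (s : seq V) : {set {set V}} :=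
  if s is x :: p then [set:: pairmap (fun a b => [set a; b]) x p] else set0.

Definition is_tree : Prop :=
  [/\ symmetric adj, irreflexive adj, forall x y, connect adj x y
    & forall c : seq V, (2 < size c)%N -> ~~ ucycleb adj c].

Definition path_from_edge (r : V) (e : {set V}) (s : seq V) : bool :=
  if s is x :: p then [&& simple_path s, x \in e & last x p == r] else false.

(* Two simple paths lead from e to r in a tree, one through e itself and one
   from the endpoint of e nearer to r; they agree outside e, so the choice made
   by pick does not matter. A simple path has at most #|V| vertices, and the
   default 0 is not reached on an edge of a tree. *)
Definition edge_dist (r : V) (e : {set V}) : nat :=
  if [pick s : {bseq #|V| of V} | path_from_edge r e s] is Some s
  then #|path_edges s :\ e| else 0%N.

End Graphs.

(* Paths may be trivial, and u may exceed the length of the path. *)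
Record fza (R : realType) := FZA {
  fza_V : finType;
  fza_adj : rel fza_V;
  fza_tree : is_tree fza_adj;
  fza_f : nat -> R;
  fza_f_ge0 : forall m, 0 <= fza_f m;
  fza_f_nondecreasing : {homo fza_f : m n / (m <= n)%N >-> m <= n};
  fza_f_concave :
    forall m, fza_f m.+2 - fza_f m.+1 <= fza_f m.+1 - fza_f m;
  fza_k : nat;
  fza_P : 'I_fza_k -> {set {set fza_V}};
  fza_P_path :
    forall i, exists2 s, simple_path fza_adj s & fza_P i = path_edges s;
  fza_u : 'I_fza_k -> nat;
  fza_w : 'I_fza_k -> nat;
  fza_w_gt0 : forall i, (0 < fza_w i)%N
}.

Section Problem.
Variables (R : realType) (I : fza R).

Definition fza_n : nat := #|fza_V I|.

Definition fza_E : {set {set fza_V I}} := edge_set (@fza_adj R I).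

Definition revenue_of (i : 'I_(fza_k I)) (F : {set {set fza_V I}}) : R :=
  let m := #|fza_P i :&: F| in
  if (m <= fza_u i)%N then (fza_w i)%:R * fza_f I m else 0.

Definition revenue (F : {set {set fza_V I}}) : R :=
  \sum_(i < fza_k I) revenue_of i F.

(* Revenues are nonnegative, so the neutral element 0 of the maximum is
   harmless. *)
Definition opt : R := \big[Num.max/0]_(F in powerset fza_E) revenue F.

Definition best_among (cand : {set {set fza_V I}} -> Prop)
    (F : {set {set fza_V I}}) : Prop :=
  cand F /\ forall G, cand G -> revenue G <= revenue F.

End Problem.

(* The density classes M_j serve only to analyse the algorithm: its output does
   not depend on them. *)
Section SingleDensity.
Variables (R : realType) (I : fza R) (r : fza_V I).

(* up_log 2 n is the ceiling of the binary logarithm of n. *)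
Definition levels : nat := up_log 2 (fza_n I).

(* One coin for each (j, theta, e), all independent and fair, i.e. the uniform
   distribution on this type; true means that e is deleted from the set
   F_(j, theta). Only the coins with 1 <= j, theta < 2 ^ (j + 1) and
   e \in F_(j, theta) are used. *)
Definition coins : finType :=
  {ffun 'I_levels.+1 * 'I_(2 ^ levels.+1) * {set fza_V I} -> bool}.

Definition Fset (j theta : nat) : {set {set fza_V I}} :=
  [set e in fza_E I | edge_dist (@fza_adj R I) r e == theta %[mod 2 ^ j.+1]].

Definition Frand (c : coins) (j : 'I_levels.+1) (theta : 'I_(2 ^ levels.+1)) :
    {set {set fza_V I}} :=
  [set e in Fset j theta | ~~ c (j, theta, e)].

(* A relation rather than a function, because ties between best sets may be
   broken arbitrarily. *)
Definition single_density_output (c : coins) (Falg : {set {set fza_V I}}) :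
    Prop :=
  exists F : 'I_levels.+1 -> {set {set fza_V I}},
    [/\ F ord0 = set0,
        forall j : 'I_levels.+1, (1 <= j)%N ->
          best_among
            (fun G => exists2 theta : 'I_(2 ^ levels.+1),
               (theta < 2 ^ j.+1)%N & G = Frand c j theta)
            (F j)
      & best_among (fun G => exists j, G = F j) Falg].

End SingleDensity.

Definition uniform_expectation (R : realType) (T : finType) (X : T -> R) : R :=
  (\sum_(t : T) X t) / #|T|%:R.

Definition log2 (R : realType) (x : R) : R := ln x / ln 2.

(* Main.v *)
(* Replace each bound u_i by m = min (u_i, |P_i|); the revenue of commodity i is
   then at most w_i f(m), whatever the zones. If m >= 1, let j be such that
   m 2^(j-1) <= |P_i| < m 2^j; since |P_i| < n, these classes number at most
   ceil (log2 n). In a rooted tree a path goes up and then down, so the distances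
   of its edges to the root form two runs of consecutive integers. Hence a
   residue class modulo q = 2^(j+1) contains at most (|P_i| + 2(q - 1)) / q of its
   edges, which is at most max (m, 2). Thus each edge of the residue class is kept
   by the coins with at most m edges in all with probability at least 1/4: only
   for m = 1 can one other edge have to be deleted. Concavity makes the revenue
   at least proportional to the number of kept edges, so on average over the q
   offsets and the coins commodity i earns at least w_i f(m) / 16. Each class
   therefore has total bound at most 16 times the expected output revenue, and
   the commodities with m = 0 earn their whole bound from the empty set. *)
Require Import Defs.
From HB Require Import structures.
From mathcomp Require Import all_boot all_order all_algebra.
From mathcomp Require Import reals exp.
From mathcomp Require Import zify lra ring.

Set Implicit Arguments.
Unset Strict Implicit.
Unset Printing Implicit Defensive.

Import Order.TTheory GRing.Theory Num.Theory.

(** * Simple paths and distances to the root in a tree *)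

Section Trees.
Variables (V : finType) (adj : rel V).

Lemma mem_path_edges_sub (s : seq V) (e : {set V}) z :
  e \in path_edges s -> z \in e -> z \in s.
Proof.
case: s => [|x p] /=; first by rewrite inE.
rewrite inE; elim: p x => [|y p IHp] x //=; rewrite inE => /predU1P[->|ep] ze.
  by move: ze; rewrite !inE => /orP[]->; rewrite ?orbT.
by rewrite inE (IHp y) ?orbT.
Qed.

Lemma uniq_path_edges x (p : seq V) : uniq (x :: p) ->
  uniq (pairmap (fun a b => [set a; b]) x p).
Proof.
elim: p x => //= y p IHp x /andP[xNyp uyp]; rewrite IHp // andbT.
apply: contra xNyp => /= xy_p.
by apply: (@mem_path_edges_sub (y :: p) [set x; y]); rewrite ?inE ?eqxx.
Qed.

Lemma card_path_edges x (p : seq V) : uniq (x :: p) ->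
  #|path_edges (x :: p)| = size p.
Proof.
by move=> /uniq_path_edges up; rewrite cardsE (card_uniqP up) size_pairmap.
Qed.

Lemma path_edges_subset (s : seq V) : sorted adj s ->
  path_edges s \subset edge_set adj.
Proof.
case: s => [|x p] /=; first by rewrite sub0set.
move=> xp; apply/subsetP=> e; rewrite inE.
elim: p x xp => //= y p IHp x /andP[xy yp]; rewrite inE => /predU1P[->|/IHp->//].
by apply/imset2P; exists x y; rewrite ?inE.
Qed.

Hypothesis treeV : is_tree adj.

Let adjC : symmetric adj. Proof. by case: treeV. Qed.
Let adjxx : irreflexive adj. Proof. by case: treeV. Qed.

(** A nontrivial simple path from [a] to [b] that avoids [x] would close up through [x] to a cycle
    on at least three vertices. *)
Lemma tree_neighbours_separated x a b : adj x a -> adj x b ->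
  connect [rel u v | [&& adj u v, u != x & v != x]] a b -> a = b.
Proof.
move=> xa xb /connectP[p ap def_b]; rewrite {b}def_b in xb *.
case/shortenP: ap xb => {}p ap up _ xb.
case: p ap up xb => // c p ap up xb.
case: treeV => _ _ _ /(_ [:: x, a, c & p] isT) /negP[].
have aNx : a != x by apply: contraTneq xa => ->; rewrite adjxx.
have xNp : {in c :: p, forall y, y != x}.
  elim: (c :: p) (a) ap => //= d q IHq e /andP[/and3P[_ _ dx] dq] y.
  by rewrite inE => /predU1P[->//|]; apply: IHq dq _.
rewrite /ucycleb cons_uniq up andbT; apply/andP; split; last first.
  rewrite inE negb_or eq_sym aNx; apply/negP => /xNp.
  by rewrite eqxx.
rewrite /cycle rcons_path /= xa (adjC _ x) [adj x _]xb andbT.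
by have := sub_path (fun u v => _) ap; apply=> u v /and3P[].
Qed.

(** If the first steps differed, both remainders would avoid [x] and meet at the common end, joining
    two distinct neighbours of [x] off [x]. *)
Lemma tree_path_unique x p q : path adj x p -> uniq (x :: p) ->
  path adj x q -> uniq (x :: q) -> last x p = last x q -> p = q.
Proof.
elim: p x q => [|a p IHp] x [|b q] //=.
- by move=> _ _ _ /andP[/negP xNq _] E; case: xNq; rewrite E mem_last.
- by move=> _ /andP[/negP xNq _] _ _ E; case: xNq; rewrite -E mem_last.
move=> /andP[xa ap] /andP[xNap uap] /andP[xb bq] /andP[xNbq ubq] E.
have avoid c s : path adj c s -> x \notin c :: s ->
    connect [rel u v | [&& adj u v, u != x & v != x]] c (last c s).
  move=> cs xNs; apply/connectP; exists s => //.
  elim: s c cs xNs => //= d s IHs c /andP[cd ds].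
  rewrite !inE !negb_or => /and3P[xc xd xs].
  by rewrite cd eq_sym xc eq_sym xd IHs // inE negb_or xd.
suff ab : a = b by rewrite -ab in bq ubq E *; rewrite (IHp a q).
apply: tree_neighbours_separated xa xb _.
apply: connect_trans (avoid _ _ ap xNap) _; rewrite E.
rewrite sym_connect_sym; first exact: avoid.
by move=> u v /=; rewrite adjC [(u != x) && _]andbC.
Qed.

Definition path_to (r x : V) (p : seq V) : bool :=
  [&& path adj x p, uniq (x :: p) & last x p == r].

Lemma path_to_exists r x : exists p, path_to r x p.
Proof.
case: treeV => _ _ /(_ x r)/connectP[p xp ->] _.
by case/shortenP: xp => q xq uq _; exists q; apply/and3P.
Qed.

Definition root_path r x : seq V := xchoose (path_to_exists r x).

Definition depth r x : nat := size (root_path r x).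

Lemma root_pathP r x : path_to r x (root_path r x).
Proof. exact: xchooseP. Qed.

Lemma root_path_unique r x p : path_to r x p -> p = root_path r x.
Proof.
case/and3P=> xp up /eqP lp; case/and3P: (root_pathP r x) => xq uq /eqP lq.
by apply: (@tree_path_unique x) => //; rewrite lp lq.
Qed.

(** If [x] is not on the root path of [y], it can be prepended to it. Otherwise the part after [x]
    is the root path of [x], and going from [y] straight to [x] is simple, hence the root path of
    [y]. *)
Lemma root_path_adj r x y : adj x y ->
  root_path r x = y :: root_path r y \/ root_path r y = x :: root_path r x.
Proof.
move=> xy; case/and3P: (root_pathP r y) => yp uyp lyp.
have [xyp|xNyp] := boolP (x \in y :: root_path r y); last first.
  by left; apply/esym/root_path_unique/and3P; split=> //=; rewrite ?xy // xNyp.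
right; move: xyp; rewrite inE => /predU1P[E|]; first by rewrite E adjxx in xy.
move=> xyp; apply/esym/root_path_unique.
move: (root_path r y) xyp yp uyp lyp => q /splitPr[p1 p2].
rewrite cat_path last_cat -cat_cons cat_uniq => /andP[_ /= /andP[_ xp2]].
case/and3P=> /andP[yNp1 _] Np1 /andP[xNp2 up2] l2.
have <- : p2 = root_path r x.
  by apply: root_path_unique; rewrite /path_to /= xNp2 up2 xp2 l2.
rewrite /path_to /= adjC xy xp2 xNp2 up2 l2 !andbT.
apply: contra Np1 => yp2; rewrite -[_ || _]/(has (mem (y :: p1)) (x :: p2)).
by apply/hasP; exists y; rewrite //= inE eqxx.
Qed.

Lemma depth_adj r x y : root_path r x = y :: root_path r y ->
  depth r x = (depth r y).+1.
Proof. by rewrite /depth => ->. Qed.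

Lemma edge_distE r x y : root_path r x = y :: root_path r y ->
  edge_dist adj r [set x; y] = depth r y.
Proof.
move=> xy; case/and3P: (root_pathP r x); rewrite xy => xp up lp.
have [adj_xy yp]: adj x y /\ path adj y (root_path r y) by case/andP: xp.
have [xNp uyp] : x \notin y :: root_path r y /\ uniq (y :: root_path r y).
  by case/andP: up.
have eN : [set x; y] \notin path_edges (y :: root_path r y).
  by apply: contra xNp => /mem_path_edges_sub; apply; rewrite !inE eqxx.
rewrite /edge_dist; case: pickP => [[[|z p] sz] //=|] /=; last first.
  (* The path from [y] fits the size bound, so [pick] succeeds and the default 0 does not arise. *)
  have sz : (size (y :: root_path r y) <= #|V|)%N.
    by rewrite -(card_uniqP uyp) max_card.
  move/(_ (Bseq sz)) => /=; rewrite /simple_path /= !inE eqxx orbT yp.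
  by move: uyp lp => /= -> /= ->.
case/and3P=> /andP[/= zp uzp] ze lz.
have {zp uzp lz} pE : p = root_path r z by apply: root_path_unique; apply/and3P.
(* From [x] the path starts with the edge itself, which is then removed; from [y] it avoids the
   edge. Both leave the root path of [y]. *)
move: ze; rewrite pE !inE => /orP[]/eqP->{z p sz pE}.
  rewrite xy; set s := y :: _.
  have -> : [set:: pairmap (fun a b => [set a; b]) x s]
      = [set x; y] |: path_edges s.
    by apply/setP=> e; rewrite !inE.
  by rewrite setU1K // card_path_edges.
rewrite -[[set:: _]]/(path_edges (y :: root_path r y)).
by rewrite (setDidPl _) ?card_path_edges // disjoint_sym disjoints1.
Qed.

Definition dist_seq r x p : seq nat :=
  map (edge_dist adj r) (pairmap (fun a b => [set a; b]) x p).

(** A path that has gone down once keeps going down: a step up would lead back to the parent just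
    left. *)
Lemma dist_seq_up r x y p : path adj x (y :: p) -> uniq [:: x, y & p] ->
  root_path r y = x :: root_path r x ->
  dist_seq r x (y :: p) = iota (depth r x) (size p).+1.
Proof.
elim: p x y => [|z p IHp] x y xp up yx.
  by rewrite /dist_seq /= setUC edge_distE.
rewrite /dist_seq map_cons setUC edge_distE // -/(dist_seq r y (z :: p)).
congr (_ :: _).
have [yp uyp] : path adj y (z :: p) /\ uniq [:: y, z & p].
  by split; [case/andP: xp | case/andP: up].
have [yz|zy] := root_path_adj r (proj1 (andP yp)).
  move: yx up; rewrite yz => -[-> _]; rewrite /= !inE eqxx orbT //.
by rewrite -(depth_adj yx); apply: IHp.
Qed.

(** The path climbs [a] edges to its vertex nearest to the root, of depth [h], then descends [b]
    edges. The equation on [h + a] gives the distance of an edge put in front, as the induction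
    needs. *)
Lemma dist_seqE r x p : path adj x p -> uniq (x :: p) ->
  exists h a b, dist_seq r x p = rev (iota h a) ++ iota h b /\ h + a = depth r x.
Proof.
elim: p x => [|y p IHp] x xp up.
  by exists (depth r x), 0, 0; rewrite addn0.
have [xy|yx] := root_path_adj r (proj1 (andP xp)); last first.
  by exists (depth r x), 0, (size p).+1; rewrite addn0 dist_seq_up.
have [yp uyp] : path adj y p /\ uniq (y :: p).
  by split; [case/andP: xp | case/andP: up].
have [h [a [b [E ha]]]] := IHp y yp uyp.
exists h, a.+1, b; split; last by rewrite addnS ha (depth_adj xy).
rewrite -[a.+1]addn1 iotaD rev_cat /dist_seq map_cons -/(dist_seq r y p) E.
by rewrite edge_distE // -ha.
Qed.

End Trees.

(** * Edges of a path in one residue class *)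

Lemma count_modn_iota q t h a : 0 < q ->
  count (fun m => m == t %[mod q]) (iota h a) * q <= a + q.-1.
Proof.
(* q divides m + 1 + t' iff m = t mod q, so the count is a difference of
   quotients by q. *)
move=> q_gt0; pose t' := q.-1 - t %% q.
have tq := ltn_pmod t q_gt0.
have E : count (fun m => m == t %[mod q]) (iota h a) + (h + t') %/ q
          = (h + a + t') %/ q.
  elim: a h => [|a IHa] h /=; first by rewrite addn0.
  rewrite addnS -addSn -IHa addSn divnS // addnCA -addnA; congr (_ + (_ + _)).
  rewrite /dvdn -[in RHS](mod0n q) -(eqn_modDr (t %% q) _ 0) add0n modn_mod.
  have -> : (h + t').+1 + t %% q = h + q by rewrite /t'; lia.
  by rewrite modnDr.
have := leq_trunc_div (h + a + t') q; have := ltn_ceil (h + t') q_gt0.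
rewrite -E mulnDl mulSn; lia.
Qed.

(** Each of the two runs of distances contributes one rounding excess [q.-1]. *)
Lemma card_path_mod_class (V : finType) (adj : rel V) r s q t :
  is_tree adj -> simple_path adj s -> 0 < q ->
  #|[set e in path_edges s | edge_dist adj r e == t %[mod q]]| * q
    <= #|path_edges s| + (q.-1).*2.
Proof.
move=> treeV; case: s => [|x p] /andP[/= xp up] q_gt0.
  by rewrite (eq_card0 (A := [set _ in _ | _])) // => e; rewrite !inE.
rewrite card_path_edges //.
have [h [a [b [E _]]]] := dist_seqE treeV r xp up.
have szE : size p = a + b.
  have := congr1 size E; rewrite size_map size_pairmap => ->.
  by rewrite size_cat size_rev !size_iota.
set A := [set e in _ | _].
have -> : #|A| = count (fun m => m == t %[mod q]) (dist_seq adj r x p).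
  rewrite /dist_seq count_map -size_filter.
  rewrite -(card_uniqP (filter_uniq _ (uniq_path_edges up))).
  by apply: eq_card => e; rewrite !inE mem_filter andbC.
rewrite E count_cat count_rev mulnDl szE.
have := count_modn_iota t h a q_gt0; have := count_modn_iota t h b q_gt0.
lia.
Qed.

(** * Counting outcomes of independent fair coins *)

Section FairCoins.
Variable K : finType.
Implicit Types (c : {ffun K -> bool}) (a b : K).

Definition flip_coin a c : {ffun K -> bool} := [ffun x => c x (+) (x == a)].

Lemma flip_coinK a : involutive (flip_coin a).
Proof. by move=> c; apply/ffunP=> x; rewrite !ffunE -addbA addbb addbF. Qed.

(** Flipping coin [a] preserves [B] and exchanges the two values of that coin. *)
Lemma card_coin_half a v (B : pred {ffun K -> bool}) :
  (forall c, B (flip_coin a c) = B c) ->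
  #|[set c | B c]| = 2 * #|[set c | B c & c a == v]|.
Proof.
move=> Binv; rewrite -(cardsID [set c : {ffun K -> bool} | c a == v]) mul2n -addnn.
congr (_ + _); first by apply: eq_card => c; rewrite !inE.
rewrite -[RHS](card_imset _ (inv_inj (flip_coinK a))); apply: eq_card => c.
rewrite (can_imset_pre _ (flip_coinK a)) !inE Binv ffunE eqxx.
by rewrite andbC; case: (c a); case: v.
Qed.

Lemma card_coin1 a v :
  #|{ffun K -> bool}| = 2 * #|[set c : {ffun K -> bool} | c a == v]|.
Proof.
rewrite -cardsT; have := @card_coin_half a v predT (fun=> erefl).
by congr (_ = _); apply: eq_card => c; rewrite !inE.
Qed.

Lemma card_coin2 a b v w : a != b ->
  #|{ffun K -> bool}| =
    4 * #|[set c : {ffun K -> bool} | (c b == w) && (c a == v)]|.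
Proof.
move=> ab; rewrite (card_coin1 b w).
rewrite (@card_coin_half a v (fun c => c b == w)) ?mulnA //.
by move=> c; rewrite ffunE [b == a]eq_sym (negPf ab) addbF.
Qed.

(** After exchanging the sums, it suffices that for each [e] in [A] a quarter of the outcomes keep
    [e] with at most [m] survivors. *)
Lemma card_thinning (T : finType) (key : T -> K) (A : {set T}) m :
    injective key -> 0 < m -> #|A| <= maxn m 2 ->
  #|A| * #|{ffun K -> bool}| <=
    4 * \sum_(c : {ffun K -> bool})
          (let X := #|[set e in A | ~~ c (key e)]| in if X <= m then X else 0).
Proof.
move=> key_inj m_gt0 A_le.
pose X (c : {ffun K -> bool}) := #|[set e in A | ~~ c (key e)]|.
have -> : \sum_(c : {ffun K -> bool})
      (let X := #|[set e in A | ~~ c (key e)]| in if X <= m then X else 0)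
    = \sum_(e in A)
      #|[set c : {ffun K -> bool} | (c (key e) == false) && (X c <= m)]|.
  transitivity (\sum_(c : {ffun K -> bool}) \sum_(e in A)
                  ((c (key e) == false) && (X c <= m))).
    apply: eq_bigr => c _; rewrite /= -/(X c); case: leqP => _.
      rewrite /X -sum1_card big_mkcond [RHS]big_mkcond; apply: eq_bigr => e _ /=.
      by rewrite inE andbT eqbF_neg; case: (e \in A); case: (c _).
    by rewrite big1 // => e _; rewrite andbF.
  rewrite exchange_big; apply: eq_bigr => e _.
  rewrite -sum1_card big_mkcond [RHS]big_mkcond.
  by apply: eq_bigr => c _; rewrite inE; case: andP.
rewrite -sum_nat_const big_distrr /=; apply: leq_sum => e eA.
(* If all of [A] fits, keeping [e] is enough, which happens for half of the outcomes. *)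
have [Am|mA] := leqP #|A| m.
  rewrite (card_coin1 (key e) false) leq_mul // subset_leq_card //.
  apply/subsetP => c; rewrite !inE => -> /=; apply: leq_trans Am.
  by apply: subset_leq_card; apply/subsetP => e'; rewrite inE => /andP[].
(* Here [m = 1] and [A] has two elements: keeping [e] and deleting the other one prescribes two
   distinct coins. *)
have A2 : #|A| <= 2 by lia.
have [e' e'A e'e] : exists2 e', e' \in A & e' != e.
  have : 0 < #|A :\ e| by move: mA; rewrite (cardsD1 e A) eA; lia.
  by case/card_gt0P => e'; rewrite !inE => /andP[]; exists e'.
rewrite (@card_coin2 (key e') (key e) true false); last first.
  by rewrite (inj_eq key_inj).
rewrite leq_mul2l subset_leq_card ?orbT //; apply/subsetP=> c; rewrite !inE.
move=> /andP[-> /eqP ce'] /=; apply: leq_trans m_gt0.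
suff : X c < #|A| by lia.
apply: proper_card; apply/properP; split.
  by apply/subsetP => x; rewrite inE => /andP[].
by exists e'; rewrite // inE ce' andbF.
Qed.

End FairCoins.

Local Open Scope ring_scope.

(** * Concave sequences *)

Section Concave.
Variables (R : realType) (f : nat -> R).
Hypothesis f_ge0 : forall m, 0 <= f m.
Hypothesis f_concave : forall m, f m.+2 - f m.+1 <= f m.+1 - f m.

(** Each of the first [m] increments is at least the next one, and [f 0] is nonnegative. *)
Lemma concave_slope m : m%:R * (f m.+1 - f m) <= f m.
Proof.
elim: m => [|m IHm]; first by rewrite mul0r.
apply: le_trans (ler_wpM2l (ler0n _ _) (f_concave m)) _.
by rewrite -natr1 mulrDl mul1r; lra.
Qed.

(** This is the monotonicity of [f m / m], cross-multiplied to include 0; [concave_slope] gives the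
    step from [b] to [b.+1]. *)
Lemma concave_ratio a b : (a <= b)%N -> a%:R * f b <= b%:R * f a.
Proof.
elim: b => [|b IHb]; first by rewrite leqn0 => /eqP->.
rewrite leq_eqVlt => /predU1P[->//|]; rewrite ltnS => ab.
have [->|a_gt0] := posnP a; first by rewrite mul0r mulr_ge0.
have b_gt0 : 0 < b%:R :> R by rewrite ltr0n (leq_trans a_gt0).
rewrite -(ler_pM2l b_gt0) mulrCA.
have : b%:R * f b.+1 <= b.+1%:R * f b.
  by have := concave_slope b; rewrite -natr1 mulrBr mulrDl mul1r; lra.
move=> /(ler_wpM2l (ler0n R a)) /le_trans -> //.
by rewrite mulrCA [leRHS]mulrCA ler_wpM2l // IHb.
Qed.

End Concave.

(** * Revenue of each commodity and each density class *)

Section Analysis.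
Variables (R : realType) (I : fza R) (r : fza_V I).
Implicit Types (i : 'I_(fza_k I)) (F : {set {set fza_V I}}).

Definition cap i : nat := minn (fza_u i) #|fza_P i|.

Definition revenue_bound i : R := (fza_w i)%:R * fza_f I (cap i).

(** For [cap i > 0] this is the [j] for which the capped density [cap i / #|fza_P i|] lies in the
    interval from [2^-j] (excluded) to [2^(1-j)] (included). *)
Definition density_class i : nat :=
  if cap i == 0%N then 0%N else (trunc_log 2 (#|fza_P i| %/ cap i)).+1.

Lemma revenue_bound_ge0 i : 0 <= revenue_bound i.
Proof. by rewrite mulr_ge0 ?ler0n ?fza_f_ge0. Qed.

Lemma revenue_of_ge0 i F : 0 <= revenue_of i F.
Proof.
by rewrite /revenue_of; case: ifP => // _; rewrite mulr_ge0 ?ler0n ?fza_f_ge0.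
Qed.

Lemma revenue_ge0 F : 0 <= revenue F.
Proof. by apply: sumr_ge0 => i _; apply: revenue_of_ge0. Qed.

Lemma revenue_of_le_bound i F : revenue_of i F <= revenue_bound i.
Proof.
rewrite /revenue_of; case: ifP => [mu|_]; last exact: revenue_bound_ge0.
rewrite ler_wpM2l ?ler0n //; apply: fza_f_nondecreasing.
by rewrite leq_min mu subset_leq_card ?subsetIl.
Qed.

Lemma opt_le_bound : opt I <= \sum_i revenue_bound i.
Proof.
apply: bigmax_le => [|F _].
  by apply: sumr_ge0 => i _; apply: revenue_bound_ge0.
by apply: ler_sum => i _; apply: revenue_of_le_bound.
Qed.

(** By concavity, [X <= cap i] edges earn at least the fraction [X / cap i] of the bound. This
    linear estimate reduces expected revenue to counting kept edges. *)
Lemma revenue_of_ge_share i F :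
  revenue_bound i *
      (if #|fza_P i :&: F| <= cap i then #|fza_P i :&: F| else 0)%N%:R <=
    (cap i)%:R * revenue_of i F.
Proof.
set X := #|_|; case: leqP => [Xc|_]; last first.
  by rewrite mulr0 mulr_ge0 ?revenue_of_ge0.
rewrite /revenue_of -/X ifT; last by apply: leq_trans Xc _; rewrite geq_minl.
rewrite mulrCA -mulrA ler_wpM2l // mulrC.
exact: concave_ratio (@fza_f_ge0 _ _) (@fza_f_concave _ _) _ _ Xc.
Qed.

Lemma card_fza_P_lt i : (#|fza_P i| < fza_n I)%N.
Proof.
have [[|x p] /andP[_ us] ->] := fza_P_path i; last first.
  rewrite card_path_edges //; have := max_card (mem (x :: p)).
  by rewrite (card_uniqP us).
(* For the empty path, the root shows that there is a vertex. *)
by rewrite cards0; apply/card_gt0P; exists r.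
Qed.

Lemma density_class_gt0 i : (0 < density_class i)%N = (0 < cap i)%N.
Proof. by rewrite /density_class; case: (cap i). Qed.

Lemma density_class_bounds i : (0 < cap i)%N ->
  (cap i * 2 ^ (density_class i).-1 <= #|fza_P i|
     < cap i * 2 ^ density_class i)%N.
Proof.
move=> c_gt0; rewrite /density_class -[cap i == 0%N]negbK -lt0n c_gt0 /=.
have d_gt0 : (0 < #|fza_P i| %/ cap i)%N by rewrite divn_gt0 // geq_minr.
have /andP[lo hi] := trunc_log_bounds (isT : 1 < 2)%N d_gt0.
by rewrite mulnC -leq_divRL // lo mulnC -ltn_divLR.
Qed.

(** For [j >= 1], [2^(j-1) <= #|fza_P i| < n <= 2^levels]. *)
Lemma density_class_le i : (density_class i <= levels I)%N.
Proof.
have [->//|d_gt0] := posnP (density_class i).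
have c_gt0 : (0 < cap i)%N by rewrite -density_class_gt0.
have /andP[lo _] := density_class_bounds c_gt0.
rewrite -(prednK d_gt0) -(ltn_exp2l _ _ (isT : 1 < 2)%N).
apply: leq_trans (up_logP (fza_n I) (isT : 1 < 2)%N).
apply: leq_ltn_trans (card_fza_P_lt i); apply: leq_trans lo.
by rewrite leq_pmull.
Qed.

Definition residue_part i q t : {set {set fza_V I}} :=
  [set e in fza_P i | edge_dist (@fza_adj R I) r e == t %[mod q]].

Lemma fza_P_Frand i (c : coins I) j t :
  fza_P i :&: Frand r c j t
    = [set e in residue_part i (2 ^ j.+1) t | ~~ c (j, t, e)].
Proof.
have [s /andP[ss _] PE] := fza_P_path i.
have /subsetP PsubE := path_edges_subset ss.
apply/setP=> e; rewrite !inE PE; case eP: (e \in path_edges s) => //=.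
by rewrite PsubE.
Qed.

Lemma sum_residue_part i q : (0 < q)%N ->
  (\sum_(t < q) #|residue_part i q t| = #|fza_P i|)%N.
Proof.
move=> q_gt0; pose res e : 'I_q :=
  Ordinal (ltn_pmod (edge_dist (@fza_adj R I) r e) q_gt0).
rewrite -sum1_card (partition_big res predT) //=; apply: eq_bigr => t _.
rewrite -sum1_card; apply: eq_bigl => e; rewrite inE -val_eqE /=.
by rewrite [(t %% q)%N]modn_small.
Qed.

Lemma card_residue_part i t : (0 < cap i)%N ->
  (#|residue_part i (2 ^ (density_class i).+1) t| <= maxn (cap i) 2)%N.
Proof.
move=> c_gt0; have /andP[_ hi] := density_class_bounds c_gt0.
have [s ss PE] := fza_P_path i.
have q_gt0 : (0 < 2 ^ (density_class i).+1)%N by rewrite expn_gt0.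
have := card_path_mod_class r t (@fza_tree R I) ss q_gt0.
rewrite -PE -/(residue_part _ _ _); move: hi q_gt0; rewrite expnS.
(* With modulus [2 * Q] and [l < cap i * Q], the estimate yields [2 * X < cap i + 4]. *)
move: (2 ^ _)%N (#|fza_P i|) (#|residue_part _ _ _|) => Q l X; rewrite -muln2.
nia.
Qed.

Lemma density_class_ltn i : (density_class i < (levels I).+1)%N.
Proof. by rewrite ltnS density_class_le. Qed.

Lemma leq_exp_levels (j : 'I_(levels I).+1) : (2 ^ j.+1 <= 2 ^ (levels I).+1)%N.
Proof. by rewrite leq_exp2l. Qed.

(** Averaged over the [2^(j+1)] offsets and the coins, at least
    [#|fza_P i| / (4 * 2^(j+1)) >= cap i / 16] edges are kept, counting only outcomes within the
    cap. *)
Lemma sum_revenue_of_Frand i (j : 'I_(levels I).+1) :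
    (0 < j)%N -> density_class i = j ->
  (2 ^ j.+1)%:R * revenue_bound i * #|coins I|%:R <=
  16 * \sum_(t < 2 ^ j.+1) \sum_(c : coins I)
         revenue_of i (Frand r c j (widen_ord (leq_exp_levels j) t)).
Proof.
move=> j_gt0 ij; have c_gt0 : (0 < cap i)%N by rewrite -density_class_gt0 ij.
have /andP[lo _] := density_class_bounds c_gt0; rewrite ij in lo.
pose X (t : 'I_(2 ^ j.+1)) (c : coins I) :=
  #|fza_P i :&: Frand r c j (widen_ord (leq_exp_levels j) t)|.
pose Y := (\sum_t \sum_c (if X t c <= cap i then X t c else 0))%N.
have thin : (#|fza_P i| * #|coins I| <= 4 * Y)%N.
  rewrite -(@sum_residue_part i (2 ^ j.+1)) ?expn_gt0 // big_distrl big_distrr /=.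
  apply: leq_sum => t _.
  have A_le : (#|residue_part i (2 ^ j.+1) t| <= maxn (cap i) 2)%N.
    by have := card_residue_part t c_gt0; rewrite ij.
  apply: leq_trans (@card_thinning _ _
    (fun e => (j, widen_ord (leq_exp_levels j) t, e)) _ _ _ c_gt0 A_le) _.
    by move=> e e' [].
  by rewrite leq_mul2l /=; apply: leq_sum => c _; rewrite /X fza_P_Frand.
have cR : 0 < (cap i)%:R :> R by rewrite ltr0n.
rewrite -(ler_pM2l cR).
have share : revenue_bound i * Y%:R <=
    (cap i)%:R * \sum_(t < 2 ^ j.+1) \sum_(c : coins I)
       revenue_of i (Frand r c j (widen_ord (leq_exp_levels j) t)).
  rewrite /Y !natr_sum !mulr_sumr; apply: ler_sum => t _.
  rewrite !natr_sum !mulr_sumr; apply: ler_sum => c _.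
  exact: revenue_of_ge_share.
rewrite [leRHS]mulrCA; apply: le_trans (ler_wpM2l (ler0n R 16) share).
have -> : (cap i)%:R * ((2 ^ j.+1)%:R * revenue_bound i * #|coins I|%:R)
    = revenue_bound i * ((cap i)%:R * (2 ^ j.+1)%:R * #|coins I|%:R) by ring.
rewrite [leRHS]mulrCA ler_wpM2l ?revenue_bound_ge0 //.
rewrite -!natrM ler_nat.
(* The modulus is [4 * 2^(j-1)], so [lo] costs a factor 4; the coins cost the other 4 of the 16. *)
move: lo thin; rewrite -(prednK j_gt0) !expnS /=.
move: (2 ^ _)%N => Q lo thin; have := leq_mul lo (leqnn #|coins I|); nia.
Qed.

(** * Comparing the output with the optimum *)

Section Output.
Variable Falg : coins I -> {set {set fza_V I}}.
Hypothesis FalgP : forall c, single_density_output r c (Falg c).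

Lemma output_subset c : Falg c \subset fza_E I.
Proof.
have [F [F0 Fj [[j ->] _]]] := FalgP c.
have [j0|j_gt0] := posnP j.
  by rewrite (_ : j = ord0) ?F0 ?sub0set //; apply: val_inj.
have [[t _ ->] _] := Fj j j_gt0.
by apply/subsetP => e; rewrite !inE => /andP[/andP[]].
Qed.

Lemma revenue_Frand_le c (j : 'I_(levels I).+1) (t : 'I_(2 ^ (levels I).+1)) :
  (0 < j)%N -> (t < 2 ^ j.+1)%N -> revenue (Frand r c j t) <= revenue (Falg c).
Proof.
move=> j_gt0 t_lt; have [F [_ Fj [_ best]]] := FalgP c.
have [_ bestj] := Fj j j_gt0; apply: le_trans (best (F j) _); last by exists j.
by apply: bestj; exists t.
Qed.

Lemma revenue_set0_le c :
  revenue (set0 : {set {set fza_V I}}) <= revenue (Falg c).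
Proof. by have [F [F0 _ [_ best]]] := FalgP c; apply: best; exists ord0. Qed.

Lemma class_bound (j : 'I_(levels I).+1) :
  (\sum_(i | density_class i == j) revenue_bound i) * #|coins I|%:R <=
  16 * \sum_c revenue (Falg c).
Proof.
have [j0|j_gt0] := posnP j.
  have S_ge0 : 0 <= \sum_c revenue (Falg c).
    by apply: sumr_ge0 => c _; apply: revenue_ge0.
  (* Commodities with cap 0 earn their bound from the empty set for every outcome, so class 0 loses
     no factor. *)
  suff : (\sum_(i | density_class i == j) revenue_bound i) * #|coins I|%:R <=
      \sum_c revenue (Falg c) by lra.
  rewrite -[#|coins I|]sum1_card natr_sum mulr_sumr; apply: ler_sum => c _.
  rewrite mulr1; apply: le_trans (revenue_set0_le c); rewrite big_mkcond.
  apply: ler_sum => i _; case: eqP => [ij|_]; last exact: revenue_of_ge0.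
  rewrite /revenue_bound /revenue_of setI0 cards0 /=.
  by have := density_class_gt0 i; rewrite ij j0; case: (cap i).
have q_gt0 : 0 < (2 ^ j.+1)%:R :> R by rewrite ltr0n expn_gt0.
rewrite -(ler_pM2l q_gt0) mulrA mulr_sumr mulr_suml.
have le1 : \sum_(i | density_class i == j)
      (2 ^ j.+1)%:R * revenue_bound i * #|coins I|%:R
   <= 16 * \sum_(t < 2 ^ j.+1) \sum_(c : coins I)
         revenue (Frand r c j (widen_ord (leq_exp_levels j) t)).
  apply: (@le_trans _ _ (\sum_(i | density_class i == j)
       16 * \sum_(t < 2 ^ j.+1) \sum_(c : coins I)
         revenue_of i (Frand r c j (widen_ord (leq_exp_levels j) t)))).
    by apply: ler_sum => i /eqP ij; apply: sum_revenue_of_Frand.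
  rewrite -mulr_sumr ler_wpM2l // exchange_big; apply: ler_sum => t _.
  rewrite exchange_big; apply: ler_sum => c _; rewrite big_mkcond.
  by apply: ler_sum => i _; case: ifP => // _; apply: revenue_of_ge0.
(* For each outcome the output is at least as good as every offset, hence as their average. *)
apply: le_trans le1 _; rewrite [leRHS]mulrCA ler_wpM2l //.
rewrite mulr_natl -[X in _ *+ X]card_ord -sumr_const; apply: ler_sum => t _.
by apply: ler_sum => c _; apply: revenue_Frand_le => //; apply: (ltn_ord t).
Qed.

Lemma opt_le_levels :
  opt I <= 16 * (levels I).+1%:R *
    uniform_expectation (fun c => revenue (Falg c)).
Proof.
have N_gt0 : 0 < #|coins I|%:R :> R.
  by rewrite ltr0n; apply/card_gt0P; exists [ffun=> false].
rewrite /uniform_expectation mulrA ler_pdivlMr //.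
apply: le_trans (ler_wpM2r (ltW N_gt0) opt_le_bound) _.
pose cls i : 'I_(levels I).+1 := Ordinal (density_class_ltn i).
rewrite (partition_big cls predT) //= mulr_suml.
rewrite [leRHS]mulrAC [leRHS]mulr_natr.
rewrite -[X in _ <= _ *+ X]card_ord -[leRHS]sumr_const.
by apply: ler_sum => j _; apply: class_bound.
Qed.

End Output.

Lemma levels_le_log2 :
  (levels I).+1%:R <= 3 * Num.max 1 (log2 (fza_n I)%:R) :> R.
Proof.
have ln2_gt0 : 0 < ln 2 :> R by rewrite ln_gt0 // ltr1n.
have M1 : 1 <= Num.max 1 (log2 (fza_n I)%:R) :> R by rewrite le_max lexx.
have Ml : log2 (fza_n I)%:R <= Num.max 1 (log2 (fza_n I)%:R) :> R.
  by rewrite le_max lexx orbT.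
have [n1|n_gt1] := leqP (fza_n I) 1.
  have -> : levels I = 0%N by apply/eqP; rewrite up_log_eq0 n1.
  by lra.
have L_gt0 : (0 < levels I)%N by rewrite up_log_gt0.
(* As [2^(levels-1) < n], [levels + 1] is at most [log2 n + 2], which the maximum with 1 absorbs. *)
suff : (levels I).-1%:R <= log2 (fza_n I)%:R :> R.
  by rewrite -{2}(prednK L_gt0) -!natr1; lra.
rewrite ler_pdivlMr // mulr_natl -lnXn // -natrX.
rewrite ler_ln ?posrE ?ltr0n ?expn_gt0 //; last first.
  exact: ltnW.
by rewrite ler_nat ltnW // up_log_gtn.
Qed.

End Analysis.

(* log n vanishes for n = 1; the maximum with 1 changes nothing for n >= 2. *)
Theorem theorem2 (R : realType) :
  exists2 C : R, 0 < C &
    forall (I : fza R) (r : fza_V I) (Falg : coins I -> {set {set fza_V I}}),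
      (forall c : coins I, single_density_output r c (Falg c)) ->
      (forall c : coins I, Falg c \subset fza_E I) /\
      opt I / (C * Num.max 1 (log2 (fza_n I)%:R))
        <= uniform_expectation (fun c : coins I => revenue (Falg c)).
Proof.
(* The constant is 16 per class times the 3 from [levels_le_log2]. *)
exists 48 => // I r Falg FalgP; split=> [c|].
  exact: output_subset FalgP c.
have M1 : 1 <= Num.max 1 (log2 (fza_n I)%:R) :> R by rewrite le_max lexx.
rewrite ler_pdivrMr; last by lra.
apply: le_trans (opt_le_levels FalgP) _; rewrite mulrC ler_wpM2l //.
  by rewrite mulr_ge0 ?invr_ge0 ?ler0n // sumr_ge0 // => c _; apply: revenue_ge0.
by have := levels_le_log2 I; lra.
Qed.
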